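(* Let $G=U_{n+1}$, $K=U_n\times U_1$ and $\mathbb{CP}^n=G/K$. Every equivariant embedding of $\mathbb{CP}^n$ into a Euclidean vector space is, up to equivalence, an orbit $U_{n+1}.f=\{f\circ g: g\in U_{n+1}\}$, where $f:\mathbb{CP}^n\to\mathbb{R}$ is a function of the form $$f([z])=\sum_{k\ge 0}a_k|z_{n+1}|^{2k}$$ for all $z=(z_1,\dots,z_{n+1})\in\mathbb{C}^{n+1}$ with $|z|=1$, with coefficients $a_k\in\mathbb{R}$ of which only finitely many are nonzero.
   Context: $\mathbb{CP}^n=\mathbb{S}^{2n+1}/\mathbb{S}^1$ with points $[z]=\mathbb{S}^1\cdot z$, $z\in\mathbb{C}^{n+1}$, $|z|=1$; $U_{n+1}$ acts by $g[z]=[gz]$; the base point is $p=[e_{n+1}]$, with stabilizer $K=U_n\times U_1$. $G$ acts on $C^\infty(\mathbb{CP}^n)$ (real-valued functions) by $(gf)(x)=f(g^{-1}x)$. Equivariant embedding: an embedding $\Phi:G/K\to V$ into a finite-dimensional Euclidean vector space with a representation $\rho:G\to O(V)$ such that $\Phi(gx)=\rho(g)\Phi(x)$ for all $g\in G$, $x\in G/K$. It is full if its image spans $V$ linearly (one may always replace $V$ by the linear span of the image). Full equivariant embeddings $\Phi:P\to V$ and $\tilde\Phi:P\to\tilde V$ are equivalent if there is a linear isometry $F:\tilde V\to V$ with $\Phi=F\circ\tilde\Phi$. That the embedding ''is the orbit of $f$'' means: it is the map $gp\mapsto gf=f\circ g^{-1}$ from $G/K$ to the finite-dimensional real linear span of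 $\{f\circ g:g\in G\}$ in $C^\infty(\mathbb{CP}^n)$, this span being equipped with some $G$-invariant inner product (the one transported from $V$). *)

(* Defs.v *)
From HB Require Import structures.
From mathcomp Require Import all_boot all_order all_algebra.
From mathcomp Require Import generic_quotient spectral sesquilinear complex.
From mathcomp Require Import all_classical all_reals all_analysis.

Set Implicit Arguments.
Unset Strict Implicit.
Unset Printing Implicit Defensive.

Import Order.TTheory GRing.Theory Num.Theory numFieldNormedType.Exports.
Local Open Scope quotient_scope.
Local Open Scope classical_set_scope.
Local Open Scope ring_scope.
Local Open Scope complex_scope.

Section UnitaryGroup.
Variables (R : realType) (n : nat).

(* U_{n+1}; the size n.+1 is that of the matrices acting on C^{n+1}. *)
Record unitary := Unitary {
  umx :> 'M[R[i]]_n.+1;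
  umx_unitary : umx \is unitarymx }.

HB.instance Definition _ := [isSub for umx].
HB.instance Definition _ := [Choice of unitary by <:].

Fact unitary1_subproof : (1%:M : 'M[R[i]]_n.+1) \is unitarymx.
Proof. by apply/unitarymxP; rewrite trmx1 map_mx1 mulmx1. Qed.

Definition unitary1 := Unitary unitary1_subproof.
Definition unitary_mul (g h : unitary) : unitary :=
  Unitary (mul_unitarymx (umx_unitary g) (umx_unitary h)).

Fact unitaryV_subproof (g : unitary) : invmx (umx g) \is unitarymx.
Proof.
by rewrite invmx_unitary ?trmxC_unitary ?umx_unitary.
Qed.

Definition unitary_inv (g : unitary) : unitary := Unitary (unitaryV_subproof g).

Fact unitary_mulA : associative unitary_mul.
Proof. by move=> g h k; apply/val_inj; exact: mulmxA. Qed.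
Fact unitary_mul1 : left_id unitary1 unitary_mul.
Proof. by move=> g; apply/val_inj; exact: mul1mx. Qed.
Fact unitary_mulr1 : right_id unitary1 unitary_mul.
Proof. by move=> g; apply/val_inj; exact: mulmx1. Qed.
Fact unitary_mulV : left_inverse unitary1 unitary_inv unitary_mul.
Proof.
by move=> g; apply/val_inj/mulVmx/unitarymx_unit/umx_unitary.
Qed.
Fact unitary_mulrV : right_inverse unitary1 unitary_inv unitary_mul.
Proof.
by move=> g; apply/val_inj/mulmxV/unitarymx_unit/umx_unitary.
Qed.

HB.instance Definition _ := isGroup.Build unitary
  unitary_mulA unitary_mul1 unitary_mulr1 unitary_mulV unitary_mulrV.

End UnitaryGroup.

Section ProjectiveSpace.
Variables (R : realType) (n : nat).
Local Notation C := R[i].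

Definition sqhnorm (z : 'cV[C]_n.+1) : C := \sum_i `|z i 0| ^+ 2.

Lemma sqhnormE (z : 'cV[C]_n.+1) : sqhnorm z = (map_mx Num.conj z^T *m z) 0 0.
Proof.
rewrite mxE; apply: eq_bigr => i _.
by rewrite !mxE normCK mulrC.
Qed.

Lemma sqhnorm_unitary (g : unitary R n) z : sqhnorm (umx g *m z) = sqhnorm z.
Proof.
rewrite !sqhnormE trmx_mul map_mxM mulmxA -[_ *m _ *m umx g]mulmxA.
rewrite -invmx_unitary ?umx_unitary//.
by rewrite mulVmx ?mulmx1// unitarymx_unit// umx_unitary.
Qed.

Lemma sqhnorm_eq0 z : (sqhnorm z == 0) = (z == 0).
Proof.
apply/idP/eqP => [|->]; last first.
  by rewrite /sqhnorm big1// => i _; rewrite mxE normr0 expr0n.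
rewrite /sqhnorm psumr_eq0 => [/allP z0|i _]; last by rewrite exprn_ge0.
apply/matrixP => i j; rewrite ord1 mxE; apply/eqP.
by have := z0 i (mem_index_enum _); rewrite /= sqrf_eq0 normr_eq0.
Qed.

(* S^{2n+1} in C^{n+1}, whose vectors are columns; the last coordinate
   z_{n+1} of z is z ord_max 0. *)
Record sphere := Sphere {
  sph_vec :> 'cV[C]_n.+1;
  sph_vecP : sqhnorm sph_vec == 1 }.

HB.instance Definition _ := [isSub for sph_vec].
HB.instance Definition _ := [Choice of sphere by <:].

Definition sph_real (z : sphere) : 'cV[R]_n.+1 * 'cV[R]_n.+1 :=
  (map_mx (@complex.Re R) z, map_mx (@complex.Im R) z).

HB.instance Definition _ := Topological.copy sphere (initial_topology sph_real).

Definition circle_rel (z w : sphere) : bool :=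
  `[< exists2 u : C, `|u| = 1 & sph_vec w = u *: sph_vec z >].

Fact circle_rel_equiv : equiv_class_of circle_rel.
Proof.
split=> [z|z w|w z t].
- by apply/asboolP; exists 1; rewrite ?normr1 ?scale1r.
- suff H z' w' : circle_rel z' w' -> circle_rel w' z' by apply/idP/idP; apply: H.
  move=> /asboolP[u u1 wE]; apply/asboolP; exists u^-1.
    by rewrite normfV u1 invr1.
  by rewrite wE scalerA mulVf ?scale1r// -normr_eq0 u1 oner_neq0.
- move=> /asboolP[u u1 wE] /asboolP[v v1 tE]; apply/asboolP; exists (v * u).
    by rewrite normrM u1 v1 mulr1.
  by rewrite tE wE scalerA.
Qed.

Canonical circle_equiv := EquivRelPack circle_rel_equiv.

Definition CP := {eq_quot circle_rel}.

HB.instance Definition _ := Quotient.on CP.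
HB.instance Definition _ := Topological.copy CP (quotient_topology CP).

Definition cp_proj (z : sphere) : CP := \pi_CP z.

Lemma cp_proj_eqP z w :
  cp_proj z = cp_proj w <-> exists2 u : C, `|u| = 1 & sph_vec w = u *: sph_vec z.
Proof.
have E := @eqmodP _ circle_equiv z w.
by split=> [/E/asboolP|uz]; last by apply/E/asboolP.
Qed.

Fact act_sphere_subproof (g : unitary R n) (z : sphere) :
  sqhnorm (umx g *m sph_vec z) == 1.
Proof. by rewrite sqhnorm_unitary sph_vecP. Qed.

Definition act_sphere g z := Sphere (act_sphere_subproof g z).

Definition cp_act (g : unitary R n) (x : CP) : CP := cp_proj (act_sphere g (repr x)).

Lemma cp_act_proj g z : cp_act g (cp_proj z) = cp_proj (act_sphere g z).
Proof.
have /cp_proj_eqP[u u1 zE] : cp_proj (repr (cp_proj z)) = cp_proj z by exact: reprK.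
by apply/cp_proj_eqP; exists u => //=; rewrite zE scalemxAr.
Qed.

Fact base_subproof : sqhnorm (delta_mx ord_max 0) == 1.
Proof.
rewrite /sqhnorm (bigD1 ord_max)//= mxE !eqxx normr1 expr1n big1 ?addr0//.
by move=> i /negPf imax; rewrite mxE imax normr0 expr0n.
Qed.

Definition base_sphere := Sphere base_subproof.
Definition cp_base : CP := cp_proj base_sphere.

(* Meaningful for z != 0 only, see normalizeE. *)
Definition normalize (z : 'cV[C]_n.+1) : sphere :=
  insubd base_sphere ((sqrtC (sqhnorm z))^-1 *: z).

Lemma normalizeE z : z != 0 ->
  sph_vec (normalize z) = (sqrtC (sqhnorm z))^-1 *: z.
Proof.
move=> z0; rewrite /normalize insubdK//.
have sz0 : 0 <= sqhnorm z by apply: sumr_ge0 => i _; rewrite exprn_ge0.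
rewrite -topredE /=; apply/eqP.
rewrite /sqhnorm; under eq_bigr do rewrite mxE normrM exprMn.
rewrite -mulr_sumr -/(sqhnorm z) normfV exprVn -normrX sqrtCK ger0_norm//.
by rewrite mulVf// sqhnorm_eq0.
Qed.

(* The standard atlas of CP^n: the inverse of the j-th affine chart sends the
   real coordinates (x, y) of w = x + i y in C^n to the point with homogeneous
   coordinates w, with 1 inserted at the j-th place. *)
Definition homogeneous (j : 'I_n.+1) (p : 'rV[R]_n * 'rV[R]_n) : 'cV[C]_n.+1 :=
  \col_k if unlift j k is Some i then p.1 0 i +i* p.2 0 i else 1.

Definition chart_inv (j : 'I_n.+1) (p : 'rV[R]_n * 'rV[R]_n) : CP :=
  cp_proj (normalize (homogeneous j p)).

End ProjectiveSpace.

Section SmoothEmbedding.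
Variable R : realType.

Fixpoint Ck (E : normedModType R) (k : nat) (h : E -> R^o) : Prop :=
  if k is k'.+1 then
    (forall x, differentiable h x) /\ (forall v, Ck k' (fun x => 'D_v h x))
  else continuous h.

Variables (n : nat) (V : vectType R) (form : {dot V for idfun}).
Variable Phi : CP R n -> V.

(* V is finite-dimensional: smoothness and differentials of V-valued maps are
   read on all linear functionals l. *)
Definition smooth := forall (j : 'I_n.+1) (l : 'Hom(V, R^o)) (k : nat),
  Ck k (fun p => l (Phi (chart_inv j p))).

Definition immersion := forall (j : 'I_n.+1) (p u : 'rV[R]_n * 'rV[R]_n),
  (forall l : 'Hom(V, R^o), 'D_u (fun q => l (Phi (chart_inv j q)) : R^o) p = 0) ->
  u = 0.

(* Continuity of the inverse of Phi on its image, for the norm of form. *)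
Definition inverse_continuous := forall (x : CP R n) (U : set (CP R n)),
  open U -> U x -> exists2 e : R, 0 < e &
    forall y, form (Phi y - Phi x) (Phi y - Phi x) < e -> U y.

Definition smooth_embedding :=
  [/\ smooth, immersion, injective Phi & inverse_continuous].

End SmoothEmbedding.

Definition linear_span (R : realType) (E : lmodType R) (S : set E) : set E :=
  [set v | exists (m : nat) (c : 'I_m -> R) (s : 'I_m -> E),
     (forall i, S (s i)) /\ v = \sum_i c i *: s i].

Section EquivariantEmbedding.
Variables (R : realType) (n : nat).

Definition orthogonal_rep (V : vectType R) (form : {dot V for idfun})
    (rho : unitary R n -> 'End(V)) : Prop :=
  [/\ rho 1%g = \1%VF,
      forall g h, rho (g * h)%g = (rho g \o rho h)%VF &
      forall g, isometry form form (rho g)].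

Definition equivariant_embedding (V : vectType R) (form : {dot V for idfun})
    (rho : unitary R n -> 'End(V)) (Phi : CP R n -> V) : Prop :=
  [/\ orthogonal_rep form rho, smooth_embedding form Phi &
      forall g x, Phi (cp_act g x) = rho g (Phi x)].

Definition full (V : vectType R) (Phi : CP R n -> V) : Prop :=
  linear_span (range Phi) = setT.

(* The action (g f)(x) = f (g^-1 x). *)
Definition fun_act (g : unitary R n) (f : CP R n -> R) : CP R n -> R :=
  f \o cp_act g^-1%g.

(* (W, rho, Psi) is the orbit map g cp_base |-> g f into the span of the f o g:
   iota identifies W, as a representation, with that space of functions. *)
Definition is_orbit (f : CP R n -> R) (W : vectType R)
    (rho : unitary R n -> 'End(W)) (Psi : CP R n -> W) : Prop :=
  exists iota : {linear W -> (CP R n -> R^o)},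
    [/\ injective iota,
        range iota = linear_span (range (fun g => f \o cp_act g : CP R n -> R^o)),
        forall g w, iota (rho g w) = fun_act g (iota w) &
        forall g, iota (Psi (cp_act g (cp_base R n))) = fun_act g f].

(* Phi is equivalent to Psi once its target is cut down to the span of its
   image, which is all of V when Phi is full. *)
Definition equivalent_to (V W : vectType R) (formV : {dot V for idfun})
    (formW : {dot W for idfun}) (Phi : CP R n -> V) (Psi : CP R n -> W) : Prop :=
  exists F : 'Hom(W, V),
    [/\ isometry formV formW F, range F = linear_span (range Phi) &
        Phi = F \o Psi].

End EquivariantEmbedding.

(* Main.v *)
(* Let W be the span of the image of Phi. Sending w to the function
   x |-> <w, Phi x> embeds W equivariantly into the functions on CP^n, and sends
   the image of the base point p to the zonal function f x = <Phi p, Phi x>, of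
   which Phi is therefore the orbit.  Invariance under the stabilizer of p makes
   f a function of |z_{n+1}|, so it is enough to know f along t |-> g_t p, where
   g_t is the complex reflection with eigenvalue e^{it} on e_1 + e_{n+1}: there
   |z_{n+1}|^2 = (1 + cos t) / 2.  Now t |-> g_t acts on W by a continuous
   2 pi-periodic one-parameter group A with even part C.  For N a large power of
   2, the discrete Fourier transform over Z/N splits any vector into eigenvectors
   of C (2 pi / N) with eigenvalues cos (2 pi k / N); as C t + c is injective for
   small t and c >= 0, halving the angle shows that they are eigenvectors of C t
   with eigenvalue cos (k t) for dyadic t, hence for all t.  So f (g_t p) is a
   polynomial in cos t, that is, in |z_{n+1}|^2. *)

Require Import Defs.
From HB Require Import structures.
From mathcomp Require Import all_boot all_order all_algebra.
From mathcomp Require Import generic_quotient spectral sesquilinear complex.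
From mathcomp Require Import all_classical all_reals all_analysis.
From mathcomp Require Import zify ring lra.

Set Implicit Arguments.
Unset Strict Implicit.
Unset Printing Implicit Defensive.

Import Order.TTheory GRing.Theory Num.Theory numFieldNormedType.Exports.
Local Open Scope ring_scope.

(** Reindexing by l -> l + 1 around the cyclic group Z/N: both sums, with [F 0] added, are the sum
    of [F] over 0, ..., N. *)
Lemma sum_ord_shift (V : zmodType) (F : nat -> V) N :
  F N = F 0%N -> \sum_(l < N) F l.+1 = \sum_(l < N) F l.
Proof.
move=> FN; apply: (@addrI _ (F 0%N)).
rewrite -(big_ord_recl N (fun l : 'I_N.+1 => F l)) big_ord_recr/= FN.
exact: addrC.
Qed.

(** * Cosine operator functions *)

Section Trigonometry.
Variable R : realType.

Lemma cos_mul2pi (k l N : nat) (d : R) : (0 < N)%N ->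
  cos (k%:R * (N%:R * (pi *+ 2 / N%:R)) + d) = cos d.
Proof.
move=> N0; have NR0 : N%:R != 0 :> R by rewrite pnatr_eq0 -lt0n.
have -> : k%:R * (N%:R * (pi *+ 2 / N%:R)) + d = d + (pi *+ 2) *+ k.
  by rewrite -[in RHS]mulr_natl; field.
exact: (periodicn (@cosD2pi R)).
Qed.

(** Orthogonality of the characters of Z/N, proved by telescoping after multiplication by sin (x /
    2). *)
Lemma sum_cos_root_unity (l N : nat) : (l < N)%N ->
  \sum_(k < N) cos (k%:R * (l%:R * (pi *+ 2 / N%:R))) =
  (if l == 0%N then N%:R else 0 : R).
Proof.
move=> lN; have N0 : (0 < N)%N by exact: leq_ltn_trans lN.
have NR0 : N%:R != 0 :> R by rewrite pnatr_eq0 -lt0n.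
case: eqP => [->|/eqP l0].
  under eq_bigr do rewrite mul0r mulr0 cos0.
  by rewrite sumr_const card_ord.
set x := l%:R * _.
pose F (k : nat) : R := sin (k%:R * x - x / 2).
(* Since 0 < l < N, the angle x / 2 = pi l / N lies strictly between 0 and pi. *)
have sx : sin (x / 2) != 0.
  have -> : x / 2 = (l%:R / N%:R) * pi :> R.
    by rewrite /x -[pi *+ 2]mulr_natr; field.
  rewrite gt_eqF// sin_gt0_pi//; apply/andP; split.
    by rewrite mulr_gt0 ?pi_gt0// divr_gt0 ?ltr0n// lt0n.
  by rewrite -[ltRHS]mul1r ltr_pM2r ?pi_gt0// ltr_pdivrMr ?ltr0n// mul1r ltr_nat.
apply: (mulfI sx); rewrite mulr0 mulr_sumr.
transitivity (\sum_(k < N) (F k.+1 - F k) / 2).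
  apply: eq_bigr => k _; rewrite /F.
  have -> : k.+1%:R * x - x / 2 = k%:R * x + x / 2 by rewrite -natr1; field.
  by rewrite sinD sinB; field.
rewrite -mulr_suml sumrB sum_ord_shift ?subrr ?mul0r// /F mul0r add0r.
have -> : N%:R * x - x / 2 = - (x / 2) + (pi *+ 2) *+ l.
  by rewrite /x -[in RHS]mulr_natl; field.
by rewrite (periodicn (@sinD2pi R)).
Qed.


Lemma cos_natS (x : R) (k : nat) :
  cos (k.+2%:R * x) = 2 * cos x * cos (k.+1%:R * x) - cos (k%:R * x).
Proof.
have -> : k.+2%:R * x = k.+1%:R * x + x by rewrite -[k.+2%:R]natr1; ring.
have -> : k%:R * x = k.+1%:R * x - x by rewrite -[k.+1%:R]natr1; ring.
by rewrite cosD cosB; ring.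
Qed.

(** These are the Chebyshev polynomials of the first kind. *)
Lemma cos_nat_poly (k : nat) :
  exists P : {poly R}, forall x, cos (k%:R * x) = P.[cos x].
Proof.
elim/ltn_ind: k => -[|[|k]] IH.
- by exists 1 => x; rewrite mul0r cos0 hornerE.
- by exists 'X => x; rewrite mul1r hornerX.
- have [P0 P0E] := IH k (ltnW (ltnSn _)); have [P1 P1E] := IH k.+1 (ltnSn _).
  by exists (2%:P * 'X * P1 - P0) => x; rewrite cos_natS P0E P1E !hornerE.
Qed.

Lemma exp2_gt (x : R) : exists m : nat, x < 2 ^+ m.
Proof.
exists (Num.truncn x).+1; apply: lt_le_trans (truncnS_gt x) _.
by rewrite -natrX ler_nat ltnW// ltn_expl.
Qed.

(** If [g t] were nonzero, [g] would not vanish within some e of t; but the grid of step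
    [t0 / 2 ^+ m] < e has a point that close to t. *)
Lemma continuous_dyadic_eq0 (t0 : R) (g : R -> R) : 0 < t0 -> continuous g ->
  (forall l m : nat, g (l%:R * (t0 / 2 ^+ m)) = 0) -> forall t : R, 0 <= t -> g t = 0.
Proof.
move=> t0_gt0 gc g0 t t_ge0; apply/eqP/negPn/negP => gt.
have /nbhs_normP[e /= e0 He] : \forall s \near t, `|g t - g s| < `|g t|.
  by have /cvgrPdist_lt H := gc t; apply: H; rewrite normr_gt0.
have [m tm] := exp2_gt (t0 / e).
set tau := t0 / 2 ^+ m.
have tau0 : 0 < tau by rewrite divr_gt0 ?exprn_gt0.
have taue : tau < e.
  by rewrite /tau ltr_pdivrMr ?exprn_gt0// mulrC -ltr_pdivrMr.
have /andP[l1 l2] := truncn_itv (divr_ge0 t_ge0 (ltW tau0)).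
have := He ((Num.truncn (t / tau))%:R * tau); rewrite g0 subr0 ltxx => H.
suff /H : ball_ (fun x : R => `|x|) t e ((Num.truncn (t / tau))%:R * tau) by [].
rewrite /ball_/= ger0_norm ?subr_ge0 -?ler_pdivlMr//.
apply: lt_trans taue; rewrite ltrBlDl -[X in _ + X]mul1r -mulrDl natr1.
by rewrite -ltr_pdivrMr.
Qed.

End Trigonometry.

(* A cosine operator function: C t = (A t + A (- t)) / 2 for a 2 pi-periodic
   one-parameter group A. *)
Section CosineFunction.
Variables (R : realType) (V : vectType R) (C : R -> 'End(V)).
Hypothesis C0 : C 0 = \1%VF.
Hypothesis dAlembert : forall s t v,
  C (s + t) v + C (s - t) v = 2 *: C s (C t v).
Hypothesis Cperiodic : forall t, C (t + pi *+ 2) = C t.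
Hypothesis Ccont : forall (l : 'Hom(V, R^o)) v,
  continuous (fun t : R => l (C t v) : R).

Lemma cosine_fctN t v : C (- t) v = C t v.
Proof.
have := dAlembert 0 t v; rewrite C0 id_lfunE add0r sub0r scaler_nat mulr2n.
by move/addrI.
Qed.

(** Operator form of 2 cos^2 (t / 2) = cos t + 1. *)
Lemma cosine_fct_half t v : 2 *: C (t / 2) (C (t / 2) v) = C t v + v.
Proof.
rewrite -dAlembert subrr C0 id_lfunE; congr (C _ v + v).
by field.
Qed.

Lemma cosine_fct_muln t c u : C t u = cos c *: u ->
  forall k, C (k%:R * t) u = cos (k%:R * c) *: u.
Proof.
move=> tc; elim/ltn_ind => -[|[|k]] IH.
- by rewrite !mul0r C0 cos0 id_lfunE scale1r.
- by rewrite !mul1r.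
- have := dAlembert (k.+1%:R * t) t u.
  have -> : k.+1%:R * t + t = k.+2%:R * t by rewrite -[k.+2%:R]natr1; ring.
  have -> : k.+1%:R * t - t = k%:R * t by rewrite -[k.+1%:R]natr1; ring.
  rewrite tc linearZ/= (IH k.+1)// (IH k) 1?ltnW// !scalerA.
  by rewrite cos_natS scalerBl => <-; rewrite addrK.
Qed.

(* Component of v on the eigenspace of C (2 pi / N) for cos (2 pi k / N). *)
Definition dft N k v : V :=
  N%:R^-1 *: \sum_(l < N) cos (k%:R * (l%:R * (pi *+ 2 / N%:R))) *:
     C (l%:R * (pi *+ 2 / N%:R)) v.

Lemma sum_dft N v : (0 < N)%N -> \sum_(k < N) dft N k v = v.
Proof.
move=> N0; rewrite -scaler_sumr exchange_big/=.
under eq_bigr => l _ do rewrite -scaler_suml sum_cos_root_unity//.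
case: N N0 => // N _; rewrite big_ord_recl/= big1 ?addr0 => [|l _]; last first.
  by rewrite scale0r.
by rewrite scalerA mulVf ?pnatr_eq0// scale1r mul0r C0 id_lfunE.
Qed.

(** By d'Alembert, 2 C t C (l t) = C ((l + 1) t) + C ((l - 1) t). Shifting the index back in each
    sum moves the shifts to the weights, and cos (k (l - 1) t) + cos (k (l + 1) t) = 2 cos (k t) cos
    (k l t). *)
Lemma cosine_fct_dft N k v : (0 < N)%N ->
  C (pi *+ 2 / N%:R) (dft N k v) = cos (k%:R * (pi *+ 2 / N%:R)) *: dft N k v.
Proof.
move=> N0; have NR0 : N%:R != 0 :> R by rewrite pnatr_eq0 -lt0n.
set t := pi *+ 2 / N%:R; have Nt : N%:R * t = pi *+ 2 by rewrite mulrC divfK.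
rewrite /dft -/t linearZ/= scalerA mulrC -scalerA; congr (_ *: _).
apply: (@scalerI _ _ 2) => //.
rewrite linear_sum/= scaler_sumr.
pose x (s : R) := C s v.
transitivity (\sum_(l < N) cos (k%:R * (l%:R * t)) *: x (l%:R * t + t)
   + \sum_(l < N) cos (k%:R * (l%:R * t)) *: x (l%:R * t - t)).
  rewrite -big_split; apply: eq_bigr => l _ /=.
  rewrite linearZ/= scalerA mulrC -scalerA -dAlembert -scalerDr; congr (_ *: _).
  rewrite (addrC t); congr (_ + _).
  by rewrite -cosine_fctN opprB.
rewrite -(@sum_ord_shift _ (fun l => cos (k%:R * (l%:R * t)) *: x (l%:R * t - t))).
  pose y (l : nat) := cos (k%:R * (l%:R * t - t)) *: x (l%:R * t).
  rewrite (eq_bigr (fun l : 'I_N => y l.+1)) => [|l _]; last first.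
    by rewrite /y -natr1 mulrDl mul1r addrK.
  rewrite (@sum_ord_shift _ y) /y.
    rewrite -big_split scalerA scaler_sumr; apply: eq_bigr => l _ /=.
    have -> : l.+1%:R * t - t = l%:R * t by rewrite -natr1 mulrDl mul1r addrK.
    rewrite -scalerDl scalerA; congr (_ *: _).
    have -> : l.+1%:R * t = l%:R * t + t by rewrite -natr1 mulrDl mul1r.
    by rewrite mulrBr mulrDr cosB cosD; ring.
  (* The terms 0 and N agree in both shifts because N t = 2 pi is a period of cos and of [C]. *)
  rewrite mul0r mulrBr cos_mul2pi//.
  by rewrite Nt /x -[pi *+ 2]add0r Cperiodic sub0r mulrN.
rewrite !mul0r sub0r mulr0 -[_ * (_ * t)]addr0 cos_mul2pi//.
by rewrite Nt addrC /x Cperiodic.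
Qed.


(* In coordinates, C t + c is the identity times 1 + c plus a small matrix. *)
Lemma near0_cosine_fct_inj : exists2 d : R, 0 < d &
  forall t c w, `|t| < d -> 0 <= c -> C t w + c *: w = 0 -> w = 0.
Proof.
pose e := vbasis (fullv : {vspace V}); pose N := \dim (fullv : {vspace V}).
have efree : free e by exact: basis_free (vbasisP _).
(* With the entries of C t - 1 below eps, the l^1 norm S of the coordinates of w satisfies (1 + c) S
   <= N eps S. As N eps < 1 <= 1 + c, this forces S = 0. *)
pose eps : R := N.+1%:R^-1.
have eps0 : 0 < eps by rewrite invr_gt0.
have /nbhs_normP[d /= d0 Hd] : \forall t \near (0 : R),
    forall ij : 'I_N * 'I_N,
    `|coord e ij.1 (C t e`_ij.2) - coord e ij.1 e`_ij.2| < eps.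
  refine (@filter_forall _ _ _ _ (nbhs_filter (0 : R)) _) => -[i j] /=.
  have := @Ccont (linfun (coord e i : V -> R^o)) e`_j 0.
  move=> /cvgrPdistC_lt/(_ _ eps0); apply: filterS => t.
  by rewrite C0 id_lfunE !lfunE.
exists d => // t c w td c0 Cw.
pose x i := coord e i w.
have we : w = \sum_(i < N) x i *: e`_i by apply: coord_vbasis; rewrite memvf.
pose S := \sum_(i < N) `|x i|.
have xi i : (1 + c) * `|x i| <= eps * S.
  have : coord e i (C t w + c *: w) = 0 by rewrite Cw linear0.
  rewrite linearD linearZ/= -/(x i).
  have -> : coord e i (C t w) =
      \sum_(j < N) x j * (coord e i (C t e`_j) - coord e i e`_j) + x i.
    rewrite {1}we !linear_sum/=; under [in RHS]eq_bigr do rewrite mulrBr.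
    rewrite sumrB; have -> : \sum_(j < N) x j * coord e i e`_j = x i.
      by rewrite /x [in RHS]we linear_sum; apply: eq_bigr => j _; rewrite linearZ.
    by rewrite subrK; apply: eq_bigr => j _; rewrite !linearZ.
  rewrite -addrA -{1}[x i]mul1r -mulrDl => /eqP; rewrite addrC addr_eq0 => /eqP E.
  rewrite -[leLHS](@ger0_norm R) ?mulr_ge0 ?addr_ge0//.
  rewrite normrM normr_id -normrM E normrN mulr_sumr.
  apply: le_trans (ler_norm_sum _ _ _) _; apply: ler_sum => j _.
  rewrite normrM mulrC ler_wpM2r// ltW//.
  by apply: (Hd t _ (i, j)); rewrite /= sub0r normrN.
have S0 : 0 <= S by apply: sumr_ge0.
have SS : (1 + c) * S <= N%:R * eps * S.
  rewrite mulr_sumr; apply: (le_trans (ler_sum _ (fun i _ => xi i))).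
  by rewrite sumr_const card_ord -mulrA mulr_natl.
have {SS}S0' : S = 0.
  apply/eqP; rewrite eq_le S0 andbT leNgt; apply/negP => Spos.
  move: SS; rewrite ler_pM2r// leNgt => /negP; apply.
  apply: (@lt_le_trans _ _ 1); last by rewrite lerDl.
  by rewrite /eps ltr_pdivrMr ?ltr0n// mul1r ltr_nat.
rewrite we big1// => i _; suff -> : x i = 0 by rewrite scale0r.
apply/eqP; rewrite -normr_le0 -S0' /S (bigD1 i)//= lerDl.
exact: sumr_ge0.
Qed.

(* With s = t / 2 and b = a / 2, (C s + cos b) (C s - cos b) kills u, and the
   first factor is injective. *)
Lemma cosine_fct_halving (t a : R) u m :
  (forall s c w, `|s| <= `|t| -> 0 <= c -> C s w + c *: w = 0 -> w = 0) ->
  0 <= a <= pi -> C t u = cos a *: u ->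
  C (t / 2 ^+ m) u = cos (a / 2 ^+ m) *: u.
Proof.
move=> inj /andP[a0 api] tu; elim: m => [|m IH]; first by rewrite expr0 !divr1.
set s := t / 2 ^+ m.+1; set b := a / 2 ^+ m.+1.
have s2 : t / 2 ^+ m = s * 2 by rewrite /s exprSr; field; rewrite expf_neq0.
have b2 : a / 2 ^+ m = b * 2 by rewrite /b exprSr; field; rewrite expf_neq0.
have e1 : 1 <= 2 ^+ m :> R by rewrite exprn_ege1// ler1n.
(* The bound a <= pi enters here: b is at least one halving away from a, so b <= pi / 2. *)
have c0 : 0 <= cos b.
  apply: cos_ge0_pihalf; apply/andP; split.
    by rewrite (@le_trans _ _ 0)// ?oppr_le0 divr_ge0 ?pi_ge0 ?exprn_ge0.
  rewrite -(@ler_pM2r _ 2)// -b2 divfK// (le_trans _ api)//.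
  by rewrite ler_pdivrMr ?exprn_gt0// ler_peMr.
apply/eqP; rewrite -subr_eq0; apply/eqP; apply: (inj s (cos b)) => //.
  rewrite /s normrM ler_piMr// normfV ger0_norm ?exprn_ge0//.
  by rewrite invf_le1 ?exprn_gt0// exprn_ege1// ler1n.
apply: (@scalerI _ _ 2) => //; rewrite scaler0 linearB linearZ/=.
rewrite scalerBr addrA subrK scalerBr.
have := cosine_fct_half (s * 2) u; rewrite mulfK// => ->.
rewrite -s2 IH b2 mulr_natr cos_mulr2n scalerBl scale1r subrK.
by rewrite !scalerA -mulr_natl expr2 mulrA subrr.
Qed.

(** Halving and then taking multiples gives the identity at all dyadic multiples of t; both sides
    are continuous in s. *)
Lemma cosine_fct_eigen (t a : R) u : 0 < t ->
  (forall s c w, `|s| <= `|t| -> 0 <= c -> C s w + c *: w = 0 -> w = 0) ->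
  0 <= a <= pi -> C t u = cos a *: u ->
  forall (l : 'Hom(V, R^o)) (s : R), 0 <= s -> l (C s u) = cos (a / t * s) * l u.
Proof.
move=> t0 inj api tu l s s0; apply/eqP; rewrite -subr_eq0; apply/eqP.
pose g s := l (C s u) - cos (a / t * s) * l u : R.
apply: (@continuous_dyadic_eq0 _ t g) s0 => //.
  move=> x; apply: cvgB; first exact: Ccont.
  apply: cvgMl; apply: continuous_comp; last exact: continuous_cos.
  by apply: cvgMr; exact: cvg_id.
move=> k m; rewrite /g (cosine_fct_muln (cosine_fct_halving m inj api tu)).
rewrite linearZ/=; apply/eqP; rewrite subr_eq0; apply/eqP; congr (cos _ * _).
by field; rewrite expf_neq0// gt_eqF.
Qed.

Theorem cosine_fct_poly (l : 'Hom(V, R^o)) v :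
  exists P : {poly R}, forall t : R, 0 <= t -> l (C t v) = P.[cos t].
Proof.
have [d d0 inj] := near0_cosine_fct_inj.
(* This m makes the angle 2 pi / 2^m smaller than d. *)
have [m Hm] := exp2_gt (pi *+ 2 / d).
pose N := (2 ^ m)%N; have N0 : (0 < N)%N by rewrite expn_gt0.
have NR0 : 0 < N%:R :> R by rewrite ltr0n.
set t := pi *+ 2 / N%:R : R.
have t0 : 0 < t by rewrite divr_gt0// pmulrn_lgt0// pi_gt0.
have td : `|t| < d.
  rewrite gtr0_norm// /t ltr_pdivrMr// mulrC -ltr_pdivrMr//.
  by rewrite /N natrX.
have {}inj s c w : `|s| <= `|t| -> 0 <= c -> C s w + c *: w = 0 -> w = 0.
  by move=> st; apply: inj; exact: le_lt_trans td.
have eig (k : 'I_N) : exists P : {poly R}, forall s : R, 0 <= s ->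
    l (C s (dft N k v)) = P.[cos s].
  (* Replacing k by N - k keeps the cosine and brings the angle into [0, pi], where halving
     applies. *)
  pose k' := if (k <= N - k)%N then k : nat else (N - k)%N.
  have kE : cos (k%:R * t) = cos (k'%:R * t).
    rewrite /k'; case: ifP => // _; rewrite natrB ?(ltnW (ltn_ord k))//.
    have -> : (N%:R - k%:R) * t = - (k%:R * t) + pi *+ 2 :> R.
      by rewrite /t; field; rewrite gt_eqF.
    by rewrite cosD2pi cosN.
  have k'N : (k'.*2 <= N)%N.
    by rewrite /k' -addnn; have := ltn_ord k; case: ifP; lia.
  have api : 0 <= k'%:R * t <= pi.
    rewrite mulr_ge0 ?(ltW t0)//= /t mulrA ler_pdivrMr// mulrnAr -mulrnAl.
    rewrite -mulr_natr -natrM muln2 mulrC ler_pM2l ?pi_gt0//.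
    by rewrite ler_nat.
  have [P PE] := cos_nat_poly R k'.
  exists (l (dft N k v) *: P) => s s0.
  have := cosine_fct_dft k v N0; rewrite -/t kE => tu.
  rewrite (cosine_fct_eigen t0 inj api tu l s0) mulfK ?gt_eqF// PE.
  by rewrite hornerZ mulrC.
have [P PE] := choice eig.
exists (\sum_k P k) => s s0; rewrite -{1}(sum_dft v N0) !linear_sum horner_sum.
by apply: eq_bigr => k _; exact: PE.
Qed.

End CosineFunction.

(** * Complex reflections and curves in CP^n *)

Section ComplexReflections.
Variables (R : realType) (n : nat).
Local Notation C := R[i].
Implicit Types (mu nu : C) (w z : 'cV[C]_n.+1).

Definition hdot w z : C := (map_mx Num.conj w^T *m z) 0 0.

Lemma hdotE w z : map_mx Num.conj w^T *m z = (hdot w z)%:M.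
Proof. by rewrite [LHS]mx11_scalar. Qed.

Lemma hdot_conj w z : (hdot w z)^* = hdot z w.
Proof.
rewrite /hdot !mxE rmorph_sum/=; apply: eq_bigr => i _.
by rewrite !mxE rmorphM/= conjCK mulrC.
Qed.

Lemma hdotBl w w' z : hdot (w - w') z = hdot w z - hdot w' z.
Proof. by rewrite /hdot linearB/= map_mxB mulmxBl !mxE. Qed.

Lemma hdotBr w z z' : hdot w (z - z') = hdot w z - hdot w z'.
Proof. by rewrite /hdot mulmxBr !mxE. Qed.

Lemma hdotDr w z z' : hdot w (z + z') = hdot w z + hdot w z'.
Proof. by rewrite /hdot mulmxDr !mxE. Qed.

Lemma hdotzz z : hdot z z = sqhnorm z.
Proof. by rewrite sqhnormE. Qed.

(* The complex reflection with eigenvalue mu on the line of w and 1 on its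
   orthogonal complement; it is the identity for w = 0. *)
Definition crefl mu w : 'M[C]_n.+1 :=
  1%:M + ((mu - 1) / sqhnorm w) *: (w *m map_mx Num.conj w^T).

(** For w != 0, let P be the orthogonal projection onto the line of w. The reflection is 1 + (mu -
    1) P, and P^2 = P. *)
Lemma creflM mu nu w : crefl mu w *m crefl nu w = crefl (mu * nu) w.
Proof.
have [->|w0] := eqVneq w 0.
  by rewrite /crefl !(mul0mx, scaler0, addr0, mulmx1).
have s0 : sqhnorm w != 0 by rewrite sqhnorm_eq0.
pose wc := map_mx Num.conj w^T; have Q : w *m wc *m (w *m wc) = sqhnorm w *: (w *m wc).
  by rewrite mulmxA -(mulmxA w) hdotE hdotzz mul_mx_scalar scalemxAl.
rewrite /crefl -/wc mulmxDl mul1mx mulmxDr mulmx1 -!scalemxAl -!scalemxAr Q.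
rewrite -!addrA; congr (_ + _); rewrite !scalerA -!scalerDl; congr (_ *: _).
by field.
Qed.

Lemma crefl1 w : crefl 1 w = 1%:M.
Proof. by rewrite /crefl subrr mul0r scale0r addr0. Qed.

Lemma crefl_adj mu w : map_mx Num.conj (crefl mu w)^T = crefl mu^* w.
Proof.
have wK : map_mx Num.conj (map_mx Num.conj w^T)^T = w.
  by apply/matrixP => i j; rewrite !mxE conjCK.
rewrite /crefl linearD/= trmx1 linearZ/= trmx_mul map_mxD map_mx1 map_mxZ.
rewrite map_mxM wK.
congr (_ + _ *: _); rewrite rmorphM/= rmorphB/= rmorph1 fmorphV; congr (_ / _).
by rewrite -hdotzz; exact: hdot_conj.
Qed.

Lemma crefl_unitary mu w : `|mu| = 1 -> crefl mu w \is unitarymx.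
Proof.
move=> mu1; apply/unitarymxP.
by rewrite crefl_adj creflM -normCK mu1 expr1n crefl1.
Qed.

Definition creflU mu w (mu1 : `|mu| = 1) : unitary R n :=
  Unitary (crefl_unitary w mu1).

Lemma mul_crefl mu w z :
  crefl mu w *m z = z + ((mu - 1) / sqhnorm w * hdot w z) *: w.
Proof.
rewrite /crefl mulmxDl mul1mx -scalemxAl -mulmxA hdotE mul_mx_scalar scalerA.
by [].
Qed.

(* The reflection sending z to z' is along z' - z, which is orthogonal to the base
   point as soon as z and z' have the same last coordinate. *)
Lemma unitary_transitive (z z' : sphere R n) : exists2 g : unitary R n,
  act_sphere g z = z' &
  sph_vec z ord_max 0 = sph_vec z' ord_max 0 ->
  act_sphere g (base_sphere R n) = base_sphere R n.
Proof.
have [->|zz'] := eqVneq z z'.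
  by exists (unitary1 R n) => [|_]; apply/val_inj; rewrite /= mul1mx.
pose w := sph_vec z' - sph_vec z; pose p := hdot (sph_vec z') (sph_vec z).
have zz : hdot (sph_vec z) (sph_vec z) = 1 by rewrite hdotzz (eqP (sph_vecP z)).
have zz1 : hdot (sph_vec z') (sph_vec z') = 1.
  by rewrite hdotzz (eqP (sph_vecP z')).
have pc : hdot (sph_vec z) (sph_vec z') = p^* by rewrite hdot_conj.
have wz : hdot w (sph_vec z) = p - 1 by rewrite /w hdotBl zz.
have sw : sqhnorm w = (1 - p) + (1 - p^*).
  by rewrite -hdotzz /w hdotBl !hdotBr zz zz1 pc -/p; ring.
have w0 : sqhnorm w != 0.
  rewrite sqhnorm_eq0 subr_eq0; apply: contra zz' => /eqP E.
  by apply/eqP/val_inj.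
(* The equality case of Cauchy-Schwarz: p = 1 would force z = z'. *)
have p1 : p - 1 != 0.
  apply: contra w0; rewrite subr_eq0 => /eqP p1.
  by rewrite sw p1 rmorph1 subrr addr0.
have pc1 : p^* - 1 != 0 by rewrite -(rmorph1 Num.conj) -rmorphB fmorph_eq0.
(* Solves (mu - 1) (p - 1) = |w|^2, so that the reflection adds exactly w to z. The numerator is
   minus the conjugate of the denominator, whence |mu| = 1. *)
pose mu := (1 - p^*) / (p - 1).
have mu1 : `|mu| = 1.
  apply/eqP; rewrite -(@eqrXn2 _ 2)// ?normr_ge0// expr1n normCK /mu.
  rewrite rmorphM/= fmorphV !rmorphB/= conjCK rmorph1; apply/eqP; field.
  by rewrite p1 pc1.
exists (creflU w mu1); [|move=> zm]; apply/val_inj; rewrite /= mul_crefl.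
  have -> : (mu - 1) / sqhnorm w * hdot w (sph_vec z) = 1.
    by rewrite wz sw /mu; field; rewrite p1 -sw w0.
  by rewrite scale1r /w addrC subrK.
have -> : hdot w (delta_mx ord_max 0) = 0.
  rewrite /hdot -colE !mxE -zm subrr.
  exact: rmorph0.
by rewrite mulr0 scale0r addr0.
Qed.

End ComplexReflections.

(** * Continuity along curves, read in the affine charts *)

Section Continuity.
Variables (R : realType) (n : nat).
Local Notation C := R[i].
Local Notation cRe := (@complex.Re R).
Local Notation cIm := (@complex.Im R).

Lemma cvg_rV (T : Type) (F : set_system T) m (f : T -> 'rV[R]_m) (y : 'rV[R]_m) :
  Filter F -> (forall i, (f x 0 i @[x --> F] --> y 0 i)%classic) ->
  (f x @[x --> F] --> y)%classic.
Proof.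
move=> FF fy; apply/cvg_ballP => e e0.
have H : \forall x \near F, forall i : 'I_m, ball (y 0 i) e (f x 0 i).
  apply: filter_forall => i.
  exact: (cvg_ballP _ _).1 (fy i) e e0.
by apply: filterS H => x H; split=> // i j; rewrite ord1.
Qed.

Lemma complexRe_div (a b : C) :
  cRe (a / b) = (cRe a * cRe b + cIm a * cIm b) / (cRe b * cRe b + cIm b * cIm b).
Proof. by case: a b => [a1 a2] [b1 b2] /=; ring. Qed.

Lemma complexIm_div (a b : C) :
  cIm (a / b) = (cIm a * cRe b - cRe a * cIm b) / (cRe b * cRe b + cIm b * cIm b).
Proof. by case: a b => [a1 a2] [b1 b2] /=; ring. Qed.

Lemma sqnorm_complex_neq0 (b : C) : b != 0 -> cRe b * cRe b + cIm b * cIm b != 0.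
Proof.
apply: contra => H; rewrite eq_complex /=.
by move: H; rewrite -!expr2 paddr_eq0 ?sqr_ge0// !sqrf_eq0.
Qed.

Lemma chart_inv_sphere (j : 'I_n.+1) (z : sphere R n) : sph_vec z j 0 != 0 ->
  cp_proj z = chart_inv j (\row_i cRe (sph_vec z (lift j i) 0 / sph_vec z j 0),
                           \row_i cIm (sph_vec z (lift j i) 0 / sph_vec z j 0)).
Proof.
set c := sph_vec z j 0 => c0; rewrite /chart_inv; set h := homogeneous _ _.
have hE : h = c^-1 *: sph_vec z.
  apply/matrixP => k l; rewrite ord1 !mxE; case: unliftP => [i ->|->].
    by rewrite !mxE [RHS]mulrC; case: (_ / _).
  by rewrite mulVf.
have z0 : sph_vec z != 0.
  by apply: contra c0 => /eqP z0; rewrite /c z0 mxE.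
have h0 : h != 0 by rewrite hE scaler_eq0 invr_eq0 (negPf c0).
have nh : sqhnorm h = `|c| ^- 2.
  rewrite hE /sqhnorm; under eq_bigr do rewrite mxE normrM exprMn.
  by rewrite -mulr_sumr -/(sqhnorm z) (eqP (sph_vecP z)) mulr1 normfV exprVn.
(* The vector h = z / c has norm 1 / |c|, so normalizing it gives z times this phase. *)
apply/cp_proj_eqP; exists (`|c| / c).
  by rewrite normrM normr_id normfV mulfV// normr_eq0.
rewrite normalizeE// nh hE scalerA; congr (_ / _ *: _).
rewrite -exprVn sqrCK ?invr_ge0// invrK.
by [].
Qed.

(** Smoothness is stated in charts only. A coordinate that is nonzero at t0 stays so nearby, hence
    the curve remains in one chart, where its real coordinates are continuous quotients. *)
Lemma smooth_curve_continuous (V : vectType R) (Phi : CP R n -> V)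
    (l : 'Hom(V, R^o)) (z : R -> sphere R n) : smooth Phi ->
  (forall k, continuous (fun t => cRe (sph_vec (z t) k 0))) ->
  (forall k, continuous (fun t => cIm (sph_vec (z t) k 0))) ->
  continuous (fun t : R => l (Phi (cp_proj (z t))) : R).
Proof.
move=> sPhi zRe zIm t0.
have [j zj] : exists j, sph_vec (z t0) j 0 != 0.
  apply/existsP; apply: contraT; rewrite negb_exists => /forallP z0.
  suff z00 : sph_vec (z t0) = 0.
    have := sph_vecP (z t0); rewrite z00.
    by rewrite (eqP (etrans (sqhnorm_eq0 0) (eqxx _))) eq_sym oner_eq0.
  by apply/matrixP => k i; rewrite ord1 mxE; apply/eqP; have := z0 k; rewrite negbK.
(* The squared modulus of the j-th coordinate, the common denominator of the chart coordinates. *)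
pose d t := cRe (sph_vec (z t) j 0) * cRe (sph_vec (z t) j 0) +
  cIm (sph_vec (z t) j 0) * cIm (sph_vec (z t) j 0).
have dc : continuous d.
  by move=> t; apply: cvgD; apply: cvgM; (exact: zRe || exact: zIm).
have d0 : d t0 != 0 by exact: sqnorm_complex_neq0.
have znear : \forall t \near t0, sph_vec (z t) j 0 != 0.
  have /cvgrPdist_lt/(_ `|d t0|) := dc t0; rewrite normr_gt0 => /(_ d0).
  apply: filterS => t; apply: contraTneq => zt.
  by rewrite /d zt /= !mulr0 addr0 subr0 ltxx.
pose p t : 'rV[R]_n * 'rV[R]_n :=
  (\row_i cRe (sph_vec (z t) (lift j i) 0 / sph_vec (z t) j 0),
   \row_i cIm (sph_vec (z t) (lift j i) 0 / sph_vec (z t) j 0)).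
have pc : {for t0, continuous p}.
  apply: (@cvg_pair _ _ _ (nbhs t0) (nbhs (p t0).1) (nbhs (p t0).2)
    _ _ _ (fun t => (p t).1) (fun t => (p t).2)).
    apply: cvg_rV => i; rewrite !mxE complexRe_div; under eq_fun do rewrite !mxE complexRe_div.
    apply: cvgM; last by apply: cvgV => //; exact: dc.
    by apply: cvgD; apply: cvgM; (exact: zRe || exact: zIm).
  apply: cvg_rV => i; rewrite !mxE complexIm_div; under eq_fun do rewrite !mxE complexIm_div.
  apply: cvgM; last by apply: cvgV => //; exact: dc.
  by apply: cvgB; apply: cvgM; (exact: zRe || exact: zIm).
have E : {near t0, (fun t => l (Phi (chart_inv j (p t))) : R) =1
    (fun t => l (Phi (cp_proj (z t))) : R)}.
  by apply: filterS znear => t zt; rewrite /= (chart_inv_sphere zt).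
rewrite /continuous_at [X in (_ --> l (Phi X))%classic](chart_inv_sphere zj).
apply: cvg_trans (near_eq_cvg E) _.
apply: (@continuous_comp _ _ _ p (fun q => l (Phi (chart_inv j q)) : R^o)) => //.
exact: (sPhi j l 0%N).
Qed.

End Continuity.

(** * Restriction to the span of the image *)

Section RealDotProducts.
Variables (R : realType) (V : vectType R) (form : {dot V for idfun}).

Lemma dotC u v : form u v = form v u.
Proof. by rewrite hermC expr0 mul1r. Qed.

Lemma dot_definite v : form v v = 0 -> v = 0.
Proof.
by apply: contra_eq => v0; rewrite gt_eqF// neq0_dnorm_gt0.
Qed.

Lemma dot_linearl u : linear (form^~ u : V -> R^o).
Proof. by move=> a v w /=; rewrite linearDl linearZl_LR. Qed.

Lemma dot_linearr u : linear (form u : V -> R^o).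
Proof. by move=> a v w /=; rewrite dotC dot_linearl !(dotC u). Qed.

(** A named head with codomain [R^o], to which the structure of a linear map can be attached. *)
Definition dot_fun u : V -> R^o := form u.

HB.instance Definition _ u := GRing.isLinear.Build R V R^o *:%R
  (dot_fun u) (dot_linearr u).

Variable U : {vspace V}.

Definition subvs_form (u v : subvs_of U) : R := form (vsval u) (vsval v).

Lemma subvs_form_bilinear :
  bilinear_for *%R (idfun \; *%R) subvs_form.
Proof.
split=> u a v w; rewrite /subvs_form.
  exact: dot_linearl.
exact: dot_linearr.
Qed.

HB.instance Definition _ := bilinear_isBilinear.Build R (subvs_of U) (subvs_of U)
  R *%R (idfun \; *%R) subvs_form subvs_form_bilinear.

Fact subvs_form_hermitian u v :
  subvs_form u v = (-1) ^+ false * idfun (subvs_form v u).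
Proof. by rewrite expr0 mul1r /subvs_form dotC. Qed.

HB.instance Definition _ := isHermitianSesquilinear.Build R (subvs_of U) false
  idfun subvs_form subvs_form_hermitian.

Fact subvs_form_gt0 u : u != 0 -> 0 < subvs_form u u.
Proof.
move=> u0; apply: neq0_dnorm_gt0; apply: contra u0 => /eqP u0.
by apply/eqP/val_inj; rewrite /= u0.
Qed.

HB.instance Definition _ := isDotProduct.Build R (subvs_of U) subvs_form
  subvs_form_gt0.

Definition subvs_dot : {dot subvs_of U for idfun} := subvs_form.

End RealDotProducts.

(** Take a finite family in S whose span has the largest possible dimension: adjoining any further
    element of S cannot enlarge that span. *)
Lemma linear_span_vspace (R : realType) (V : vectType R) (S : set V) :
  exists U : {vspace V},
    (forall x, S x -> x \in U) /\ (forall v, v \in U -> linear_span S v).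
Proof.
pose P d := `[< exists2 X : seq V,
  (forall x, x \in X -> S x) & \dim (span X) = d >].
have P0 : exists d, P d.
  by exists 0%N; apply/asboolP; exists [::]; rewrite ?span_nil ?dimv0.
have Pb d : P d -> (d <= \dim (fullv : {vspace V}))%N.
  by move=> /asboolP[X _ <-]; apply: dimvS; exact: subvf.
case: (ex_maxnP P0 Pb) => d /asboolP[X XS Xd] dmax.
exists (span X); split=> [x Sx|v].
  have /dmax : P (\dim (span (x :: X))).
    apply/asboolP; exists (x :: X) => // y; rewrite inE => /orP[/eqP->//|].
    exact: XS.
  have XxX : (span X <= span (x :: X))%VS.
    by apply: sub_span => y yX; rewrite inE yX orbT.
  rewrite -Xd (geq_leqif (dimv_leqif_eq XxX)) => /eqP ->.
  by rewrite memv_span// mem_head.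
move=> /(@coord_span _ _ _ (in_tuple X)) vE.
exists (size X), (fun i => coord (in_tuple X) i v), (fun i : 'I_(size X) => X`_i).
by split=> // i; apply: XS; rewrite mem_nth.
Qed.

Section Restriction.
Variables (R : realType) (n : nat) (V : vectType R) (form : {dot V for idfun}).
Variables (rho : unitary R n -> 'End(V)) (Phi : CP R n -> V).
Variable U : {vspace V}.
Hypothesis PhiU : forall x, Phi x \in U.
Hypothesis U_span : forall v, v \in U -> linear_span (range Phi) v.

Definition restr_map (x : CP R n) : subvs_of U := vsproj U (Phi x).

Definition restr_rep g : 'End(subvs_of U) :=
  (linfun (vsproj U) \o rho g \o linfun vsval)%VF.

Lemma vsval_restr_map x : vsval (restr_map x) = Phi x.
Proof. exact: vsprojK. Qed.

Lemma restr_map_full : full restr_map.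
Proof.
apply/seteqP; split=> // w _.
have [m [c [s [sP wE]]]] := U_span (subvsP w).
exists m, c, (fun i => vsproj U (s i)); split.
  by move=> i; have [x _ <-] := sP i; exists x.
by rewrite -[w]vsvalK wE linear_sum; apply: eq_bigr => i _; rewrite linearZ.
Qed.

Hypothesis Phi_equivariant : equivariant_embedding form rho Phi.

(** The compression of [rho g] to U is a true restriction, since equivariance makes the span of the
    image stable under [rho g]. *)
Lemma vsval_restr_rep g w : vsval (restr_rep g w) = rho g (vsval w).
Proof.
have [_ _ Phig] := Phi_equivariant.
rewrite /restr_rep !comp_lfunE !lfunE /= vsprojK//.
have [m [c [s [sP ->]]]] := U_span (subvsP w).
rewrite linear_sum; apply: memv_suml => i _; rewrite linearZ memvZ//.
by have [x _ <-] := sP i; rewrite /= -Phig.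
Qed.

Lemma restr_equivariant_embedding :
  equivariant_embedding (subvs_dot form U) restr_rep restr_map.
Proof.
have [[rho1 rhoM rho_iso] [Psm Pim Pinj Pinv] Phig] := Phi_equivariant.
split; first split.
- by apply/lfunP => w; apply/val_inj; rewrite /= vsval_restr_rep rho1 !id_lfunE.
- move=> g h; apply/lfunP => w; apply/val_inj.
  by rewrite /= comp_lfunE !vsval_restr_rep rhoM comp_lfunE.
- by move=> g u v; rewrite /= /subvs_form !vsval_restr_rep; exact: rho_iso.
- split.
  (* Functionals on U extend to V through the projection; for the immersion below, functionals on V
     restrict to U. *)
  + move=> j l k; have := Psm j (l \o linfun (vsproj U))%VF k.
    by under eq_fun do rewrite comp_lfunE lfunE.
  + move=> j p u Hl; apply: (Pim j p) => l.
    rewrite -[RHS](Hl (l \o linfun vsval)%VF); congr ('D_u _ p).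
    by apply/funext => q; rewrite comp_lfunE lfunE /= vsval_restr_map.
  + by move=> x y /(congr1 vsval); rewrite !vsval_restr_map => /Pinj.
  + move=> x O Oop Ox; have [e e0 He] := Pinv x O Oop Ox.
    exists e => // y yx; apply: He.
    by rewrite -!vsval_restr_map.
- by move=> g x; apply/val_inj; rewrite /= vsval_restr_rep !vsval_restr_map Phig.
Qed.

Lemma equivalent_to_restr : equivalent_to form (subvs_dot form U) Phi restr_map.
Proof.
exists (linfun vsval); split.
- by move=> u v; rewrite !lfunE.
- apply/seteqP; split=> [v [w _ <-]|v [m [c [s [sP ->]]]]].
    by rewrite lfunE; apply: U_span; exact: subvsP.
  have sU : \sum_(i < m) c i *: s i \in U.
    by apply: memv_suml => i _; rewrite memvZ//; have [x _ <-] := sP i.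
  by exists (vsproj U (\sum_(i < m) c i *: s i)) => //; rewrite lfunE /= vsprojK.
- by apply/funext => x; rewrite /= lfunE /= vsval_restr_map.
Qed.

End Restriction.

(** * Zonal functions *)

Section Rotations.
Variables (R : realType) (n : nat).
Local Notation C := R[i].
Implicit Types (w z : 'cV[C]_n.+1) (t : R).

Definition cis t : C := Complex (cos t) (sin t).

Lemma cisD s t : cis (s + t) = cis s * cis t.
Proof. by apply/eqP; rewrite eq_complex /= cosD sinD eqxx/= addrC. Qed.

Lemma cis_norm t : `|cis t| = 1.
Proof. by rewrite normc_def /= cos2Dsin2 sqrtr1. Qed.

Definition rot w t : unitary R n := creflU w (cis_norm t).

Lemma rotD w s t : rot w (s + t) = (rot w s * rot w t)%g.
Proof. by apply/val_inj; rewrite /= creflM cisD. Qed.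

Lemma rot0 w : rot w 0 = 1%g.
Proof. by apply/val_inj; rewrite /= /cis cos0 sin0; exact: crefl1. Qed.

Lemma rotD2pi w t : rot w (t + pi *+ 2) = rot w t.
Proof. by apply/val_inj; rewrite /= /cis cosD2pi sinD2pi. Qed.

(** The real and imaginary parts of each coordinate are affine in cos t and sin t. *)
Lemma rot_coord_continuous w (z : sphere R n) k :
  continuous (fun t => complex.Re (sph_vec (act_sphere (rot w t) z) k 0)) /\
  continuous (fun t => complex.Im (sph_vec (act_sphere (rot w t) z) k 0)).
Proof.
pose b := (sqhnorm w)^-1 * hdot w (sph_vec z) * w k 0.
have E t : sph_vec (act_sphere (rot w t) z) k 0 =
    sph_vec z k 0 + (cis t - 1) * b.
  by rewrite /= mul_crefl !mxE /b; ring.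
have cost c : continuous (fun t => (cos t - 1) * c : R).
  move=> t; apply: cvgMr_tmp; apply: cvgB; first exact: continuous_cos.
  exact: cvg_cst.
have sint c : continuous (fun t => sin t * c : R).
  by move=> t; apply: cvgMr_tmp; exact: continuous_sin.
case: (sph_vec z k 0) (b) E => z1 z2 [b1 b2] E; split=> t.
  have ReE s : complex.Re (sph_vec (act_sphere (rot w s) z) k 0) =
      z1 + ((cos s - 1) * b1 - sin s * b2) by rewrite E /=; ring.
  under eq_fun do rewrite ReE.
  by apply: cvgD; [exact: cvg_cst|apply: cvgB; [exact: cost|exact: sint]].
have ImE s : complex.Im (sph_vec (act_sphere (rot w s) z) k 0) =
    z2 + ((cos s - 1) * b2 + sin s * b1) by rewrite E /=; ring.
under eq_fun do rewrite ImE.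
by apply: cvgD; [exact: cvg_cst|apply: cvgD; [exact: cost|exact: sint]].
Qed.

End Rotations.

(** * Matrix coefficients and the zonal polynomial *)

Section Zonal.
Variables (R : realType) (n : nat) (V : vectType R) (form : {dot V for idfun}).
Variables (rho : unitary R n -> 'End(V)) (Phi : CP R n -> V).
Hypothesis Phi_equivariant : equivariant_embedding form rho Phi.
Hypothesis Phi_full : full Phi.

Local Notation p := (cp_base R n).

Definition matrix_coef (v : V) : CP R n -> R^o := fun x => form v (Phi x).

Fact matrix_coef_linear : linear matrix_coef.
Proof. by move=> a v w; apply/funext => x; exact: dot_linearl. Qed.

HB.instance Definition _ := GRing.isLinear.Build R V (CP R n -> R^o) *:%R
  matrix_coef matrix_coef_linear.

Lemma full_span v : exists (m : nat) (c : 'I_m -> R) (x : 'I_m -> CP R n),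
  v = \sum_i c i *: Phi (x i).
Proof.
have : linear_span (range Phi) v by rewrite Phi_full.
move=> [m [c [s [sP ->]]]].
have [x xE] := choice (fun i => let: ex_intro2 y _ yE := sP i in ex_intro _ y yE).
by exists m, c, x; apply: eq_bigr => i _; rewrite xE.
Qed.

Lemma cp_base_transitive x : exists g : unitary R n, cp_act g p = x.
Proof.
have [g gE _] := unitary_transitive (base_sphere R n) (repr x).
by exists g; rewrite cp_act_proj gE; exact: reprK.
Qed.

Lemma form_rho_inv g u v : form (rho g u) v = form u (rho g^-1%g v).
Proof.
have [[rho1 rhoM rho_iso] _ _] := Phi_equivariant.
by rewrite -[in RHS](rho_iso g) -comp_lfunE -rhoM mulgV rho1 id_lfunE.
Qed.

Lemma matrix_coef_orbit : is_orbit (matrix_coef (Phi p)) rho Phi.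
Proof.
have [[rho1 rhoM rho_iso] _ Phig] := Phi_equivariant.
have iotag g w : matrix_coef (rho g w) = fun_act g (matrix_coef w).
  by apply/funext => x; rewrite /matrix_coef /fun_act /= Phig form_rho_inv.
have iota_orbit g : matrix_coef (Phi (cp_act g p)) = fun_act g (matrix_coef (Phi p)).
  by rewrite Phig iotag.
exists matrix_coef; split=> //.
(* A vector orthogonal to the whole image, which spans V, is orthogonal to itself. *)
- apply: raddf_inj => v v0; apply: (@dot_definite _ _ form).
  have [m [c [x vE]]] := full_span v.
  rewrite -/(dot_fun form v v) [X in dot_fun _ _ X]vE linear_sum big1// => i _.
  by rewrite linearZ /= /dot_fun -/(matrix_coef v (x i)) v0 scaler0.
- apply/seteqP; split=> [_ [v _ <-]|_ [m [c [s [sP ->]]]]].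
    have [m [c [x ->]]] := full_span v.
    exists m, c, (fun i => matrix_coef (Phi (x i))); split; last first.
      by rewrite linear_sum; apply: eq_bigr => i _; rewrite linearZ.
    move=> i; have [g <-] := cp_base_transitive (x i).
    (* The inverse appears because [fun_act g] composes with the action of g^-1, while the span is
       generated by the f o g. *)
    by exists g^-1%g => //; rewrite iota_orbit.
  have [g gE] := choice (fun i => let: ex_intro2 y _ yE := sP i in ex_intro _ y yE).
  exists (\sum_i c i *: Phi (cp_act (g i)^-1%g p)) => //.
  rewrite linear_sum; apply: eq_bigr => i _; rewrite linearZ /= iota_orbit -gE.
  by rewrite /fun_act invgK.
Qed.

(** Continuity of [rho] is inherited from [Phi]: by fullness v is a combination of vectors [Phi x],
    and [rho g] sends these to [Phi (g x)]. *)
Lemma rot_rep_continuous (l : 'Hom(V, R^o)) w v :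
  continuous (fun t : R => l (rho (rot w t) v) : R).
Proof.
have [_ [sPhi _ _ _] Phig] := Phi_equivariant.
have [m [c [x ->]]] := full_span v => t.
have E : (fun t : R => l (rho (rot w t) (\sum_i c i *: Phi (x i))) : R) =
    (fun t => \sum_i c i * l (Phi (cp_proj (act_sphere (rot w t) (repr (x i)))))).
  apply/funext => s; rewrite !linear_sum; apply: eq_bigr => i _.
  by rewrite !linearZ/= -Phig -cp_act_proj -[in LHS](reprK (x i)).
rewrite E; apply: cvg_big => [|i _]; first exact: add_continuous.
apply: cvgMl_tmp; apply: (smooth_curve_continuous sPhi) => k.
  by have [] := rot_coord_continuous w (repr (x i)) k.
by have [] := rot_coord_continuous w (repr (x i)) k.
Qed.

(** A unitary map taking z to z' and fixing the base point acts by an isometry that fixes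
    [Phi p]. *)
Lemma zonal_invariant (z z' : sphere R n) :
  sph_vec z ord_max 0 = sph_vec z' ord_max 0 ->
  matrix_coef (Phi p) (cp_proj z) = matrix_coef (Phi p) (cp_proj z').
Proof.
have [[_ _ rho_iso] _ Phig] := Phi_equivariant.
have [g gz gbase] := unitary_transitive z z'.
move=> /gbase gp; rewrite /matrix_coef -gz -cp_act_proj Phig.
have {2}-> : Phi p = rho g (Phi p) by rewrite -Phig cp_act_proj gp.
by rewrite rho_iso.
Qed.

Lemma rot_coef_poly w : exists P : {poly R}, forall t : R, 0 <= t ->
  matrix_coef (Phi p) (cp_act (rot w t) p) = P.[cos t].
Proof.
have [[rho1 rhoM rho_iso] _ Phig] := Phi_equivariant.
pose A t := rho (rot w t).
have AD s t v : A (s + t) v = A s (A t v) by rewrite /A rotD rhoM comp_lfunE.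
(* The even part of the one-parameter group [A]; d'Alembert's equation follows from A (s + t) = A s
   A t. *)
pose K t : 'End(V) := 2^-1 *: (A t + A (- t)).
have KE t v : K t v = 2^-1 *: (A t v + A (- t) v).
  by rewrite scale_lfunE add_lfunE.
have K0 : K 0 = \1%VF.
  apply/lfunP => v; rewrite KE oppr0 /A rot0 rho1 id_lfunE.
  by rewrite -mulr2n -[v *+ 2]scaler_nat scalerA mulVf ?scale1r.
have KdA s t v : K (s + t) v + K (s - t) v = 2 *: K s (K t v).
  rewrite !KE !linearZ/= -!scalerDr; congr (2^-1 *: _).
  rewrite scalerA mulfV// scale1r !linearD/= -!AD opprK.
  by rewrite addrACA; congr (_ + _); exact: addrC.
have Kper t : K (t + pi *+ 2) = K t.
  apply/lfunP => v; rewrite !KE /A rotD2pi.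
  by rewrite -[in LHS](rotD2pi w (- _)) opprD subrK.
have Kcont (l : 'Hom(V, R^o)) v : continuous (fun t : R => l (K t v) : R).
  move=> t; under eq_fun do rewrite KE linearZ linearD/=.
  apply: cvgMl_tmp; apply: cvgD; first exact: rot_rep_continuous.
  apply: (@continuous_comp _ _ _ (fun s : R => - s) (fun s : R => l (A s v) : R)).
    exact: opp_continuous.
  exact: rot_rep_continuous.
pose l : 'Hom(V, R^o) := linfun (dot_fun form (Phi p)).
have [P PE] := cosine_fct_poly K0 KdA Kper Kcont l (Phi p).
exists P => t t0; rewrite -PE// lfunE KE linearZ linearD /= /dot_fun.
(* A (- t) is the adjoint of A t, so both have the same diagonal coefficient at [Phi p], and passing
   to the even part loses nothing. *)
have -> : A (- t) = rho (rot w t)^-1%g.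
  rewrite /A; congr rho; apply: (@mulgI _ (rot w t)).
  by rewrite mulgV -rotD subrr rot0.
rewrite -form_rho_inv [X in _ *: (_ + X)]dotC /matrix_coef Phig.
by move: (form _ _) => x; rewrite /GRing.scale /=; field.
Qed.

Lemma scale_sphere_subproof (u : R[i]) (z : sphere R n) : `|u| = 1 ->
  sqhnorm (u *: sph_vec z) == 1.
Proof.
move=> u1; rewrite /sqhnorm; under eq_bigr do rewrite mxE normrM u1 mul1r.
exact: sph_vecP.
Qed.

Lemma sphere_coord_le1 (z : sphere R n) k :
  ComplexField.Normc.normc (sph_vec z k 0) ^+ 2 <= 1.
Proof.
have : `|sph_vec z k 0| ^+ 2 <= 1.
  rewrite -(eqP (sph_vecP z)) /sqhnorm (bigD1 k)//= lerDl.
  by apply: sumr_ge0 => i _; rewrite exprn_ge0.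
rewrite -[`|_|]/((ComplexField.Normc.normc _)%:C)%C -rmorphXn.
by rewrite -(rmorph1 (@real_complex R)) lecR.
Qed.

Lemma unit_ratio (a c : R[i]) : `|a| = `|c| -> exists2 u, `|u| = 1 & u * a = c.
Proof.
have [->|a0] := eqVneq a 0.
  rewrite normr0 => /esym/eqP; rewrite normr_eq0 => /eqP ->.
  by exists 1; rewrite ?normr1 ?mulr0.
move=> ac; exists (c / a); last by rewrite divfK.
by rewrite normrM normfV -ac mulfV// normr_eq0.
Qed.

(** A phase applied to z leaves its class unchanged and makes the last coordinates equal, not only
    their moduli. *)
Lemma zonal_eq (z z' : sphere R n) :
  `|sph_vec z ord_max 0| = `|sph_vec z' ord_max 0| ->
  matrix_coef (Phi p) (cp_proj z) = matrix_coef (Phi p) (cp_proj z').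
Proof.
move=> /unit_ratio[u u1 uz].
have <- : cp_proj (Sphere (scale_sphere_subproof z u1)) = cp_proj z.
  by apply/esym/cp_proj_eqP; exists u.
by apply: zonal_invariant; rewrite /= mxE.
Qed.

Lemma zonal_poly : exists Q : {poly R}, forall z : sphere R n,
  matrix_coef (Phi p) (cp_proj z) =
    Q.[ComplexField.Normc.normc (sph_vec z ord_max 0) ^+ 2].
Proof.
(* For n = 0 there is no second axis to rotate towards, but the last coordinate always has modulus
   1, so f is constant. *)
have [n0|n0] := posnP n.
  exists (matrix_coef (Phi p) p)%:P => z; rewrite hornerC; apply: zonal_eq.
  have coord1 (y : sphere R n) : `|sph_vec y ord_max 0| = 1.
    apply/eqP; rewrite -(@eqrXn2 _ 2)// expr1n -(eqP (sph_vecP y)).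
    rewrite /sqhnorm (bigD1 ord_max)//= big1 ?addr0// => i.
    by rewrite -val_eqE /= => /eqP ni; exfalso; move: (ltn_ord i) ni; lia.
  by rewrite !coord1.
pose w : 'cV[R[i]]_n.+1 := delta_mx ord_max 0 + delta_mx ord0 0.
have max0 : (ord_max == ord0 :> 'I_n.+1) = false by rewrite -val_eqE /= gtn_eqF.
have w1 : hdot w (delta_mx ord_max 0) = 1.
  rewrite /hdot -colE !mxE !eqxx /= max0 /= addr0; exact: rmorph1.
have w2 : hdot w (delta_mx ord0 0) = 1.
  rewrite /hdot -colE !mxE !eqxx /= eq_sym max0 /= add0r; exact: rmorph1.
have sw : sqhnorm w = 2 by rewrite -hdotzz {2}/w hdotDr w1 w2.
have [P PE] := rot_coef_poly w.
(* This inverts r^2 = (1 + cos t) / 2, where r = |z_{n+1}|. *)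
exists (P \Po (2%:P * 'X - 1)) => z.
have QE (s : R) : (P \Po (2%:P * 'X - 1)).[s] = P.[2 * s - 1].
  by rewrite horner_comp !hornerE.
rewrite QE; set r := ComplexField.Normc.normc _.
have r01 : -1 <= 2 * r ^+ 2 - 1 <= 1.
  have r1 : r ^+ 2 <= 1 := sphere_coord_le1 z ord_max.
  by have r0 : 0 <= r ^+ 2 := sqr_ge0 _; lra.
(* With t = acos (2 r^2 - 1) >= 0, the rotated base point and z have last coordinates of equal
   modulus. *)
rewrite -(acosK r01) -PE ?acos_ge0// cp_act_proj; apply: zonal_eq.
set t := acos _.
rewrite /= mul_crefl !mxE !eqxx /= max0 /= w1 sw addr0 !mulr1.
have -> : 1 + (cis t - 1) / 2 = (1 + cis t) / 2 by field.
rewrite [RHS]normc_def.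
have -> : complex.Re ((1 + cis t) / 2) = (1 + cos t) / 2.
  by rewrite complexRe_div /=; field.
have -> : complex.Im ((1 + cis t) / 2) = sin t / 2.
  by rewrite complexIm_div /=; field.
have -> : ((1 + cos t) / 2) ^+ 2 + (sin t / 2) ^+ 2 = r ^+ 2.
  by rewrite !exprMn sin2cos2 acosK//; field.
have r0 : 0 <= r.
  by rewrite /r; case: (sph_vec z _ _) => x y; exact: sqrtr_ge0.
by rewrite sqrtr_sqr (ger0_norm r0).
Qed.
End Zonal.

Theorem proposition3 (R : realType) (n : nat) (V : vectType R)
    (formV : {dot V for idfun}) (rhoV : unitary R n -> 'End(V))
    (Phi : CP R n -> V) :
  equivariant_embedding formV rhoV Phi ->
  exists (f : CP R n -> R) (a : seq R),
    (forall z : sphere R n,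
       f (cp_proj z) =
         \sum_(k < size a)
           a`_k * ComplexField.Normc.normc (sph_vec z ord_max 0) ^+ (2 * k))
    /\ exists (W : vectType R) (formW : {dot W for idfun})
              (rhoW : unitary R n -> 'End(W)) (Psi : CP R n -> W),
         [/\ equivariant_embedding formW rhoW Psi, full Psi,
             is_orbit f rhoW Psi & equivalent_to formV formW Phi Psi].
Proof.
move=> Phi_equiv; have [U [PhiU U_span]] := linear_span_vspace (range Phi).
have {}PhiU x : Phi x \in U by apply: PhiU; exists x.
have Psi_equiv := restr_equivariant_embedding PhiU U_span Phi_equiv.
have Psi_full := restr_map_full U_span.
have [Q QE] := zonal_poly Psi_equiv Psi_full.
(* The polynomial [Q] serves as its own sequence of coefficients; evaluation at r^2 produces the
   even exponents. *)
exists (matrix_coef (subvs_dot formV U) (restr_map Phi U) (restr_map Phi U (cp_base R n))), Q.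
split=> [z|].
  by rewrite QE horner_coef; apply: eq_bigr => k _; rewrite exprM.
exists (subvs_of U), (subvs_dot formV U), (restr_rep rhoV U), (restr_map Phi U).
split=> //; first exact: matrix_coef_orbit.
exact: equivalent_to_restr.
Qed.
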